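(* For every real $x\ge 3$, we have $$e^{m(x)}-1<\psi'(x)<e^{M(x)}-1,$$ where $$m(x)=\frac1x-\frac{1}{24x^4}+\frac{7}{360x^6}\quad\text{and}\quad M(x)=m(x)+\frac{1}{90x^7}.$$
   Context: $\Gamma(z)=\int_0^\infty t^{z-1}e^{-t}\,dt$ for $\Re(z)>0$ is the classical Euler gamma function; $\psi(z)=\frac{d}{dz}[\ln\Gamma(z)]=\frac{\Gamma'(z)}{\Gamma(z)}$ is the digamma function; and its derivative $\psi'$ is the trigamma function. *)

(* Defs.v *)
From Stdlib Require Import Reals.
From Coquelicot Require Import Coquelicot.
Open Scope R_scope.

(* Euler's integral as an improper Riemann integral over ]0, +oo[ ; [Rpower] is
   only evaluated at t > 0, and the definition is meaningful for x > 0. *)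
Definition Gamma (x : R) : R :=
  RInt_gen (fun t => Rpower t (x - 1) * exp (- t))
    (at_right 0) (Rbar_locally p_infty).

Definition digamma (x : R) : R := Derive (fun y => ln (Gamma y)) x.

Definition trigamma (x : R) : R := Derive digamma x.

Definition m (x : R) : R := 1 / x - 1 / (24 * x ^ 4) + 7 / (360 * x ^ 6).

Definition M (x : R) : R := m x + 1 / (90 * x ^ 7).

(* Main.v *)
Require Import Defs.
From Stdlib Require Import Reals Lra.
From Coquelicot Require Import Coquelicot.
Open Scope R_scope.

(** The proof has three independent ingredients.

    1. The trigamma function is the series sum_k 1/(x+k)^2.  As in the Bohr-Mollerup
    theorem, the recurrence [Gamma_succ] and Gautschi's inequality [Gamma_Gautschi]
    determine the increments of ln Gamma far to the right: on intervals of length at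
    most one they agree with those of Stirling's function y ln y - y up to O(1/y)
    ([ln_Gamma_stirling_increment]).  Pulling back to x by the recurrence, ln Gamma
    is a pointwise limit of explicit functions whose first two derivatives are
    [digamma_seq] and [trigamma_seq].  A pointwise limit can be differentiated once
    the second derivatives are uniformly bounded and the first ones converge at the
    point ([is_derive_pointwise_lim]); applying this to ln Gamma and then to digamma
    gives [is_lim_seq_trigamma].

    2. Let t = 1/x.  Truncations P(t) of the asymptotic expansion
    t + t^2/2 + t^3/6 - t^5/30 + t^7/42 - t^9/30 + ... bound the series because
    P(1/y) - P(1/(y+1)) is comparable with 1/y^2: the difference is a rational
    function of y whose numerator has coefficients of one sign.  Comparing the
    series with a telescoping one gives [trigamma_gt_lower] and
    [trigamma_lt_upper].

    3. It remains to compare exp of the polynomials m and M in t with 1 + P(t)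
    for 0 <= t <= 1/3.  Both sides equal 1 at t = 0, and the derivative of
    (1 + P) exp(-q) has the sign of the polynomial P' - q' (1 + P)
    ([one_plus_vs_exp]).  Since m matches ln (1 + P) up to order 6 and M up to
    order 7, that polynomial is z^6 or z^7 times a factor with dominant constant
    term.  The bound 1/3 on t is the hypothesis x >= 3. *)

(** * Improper integrals of nonnegative functions on the half-line *)

Lemma ball_R (x y : R) (e : posreal) : ball x e y <-> x - e < y < x + e.
Proof.
  unfold ball; simpl; unfold AbsRing_ball, abs, minus, plus, opp; simpl. split.
  - intros H. apply Rabs_def2 in H. lra.
  - intros H. apply Rabs_def1; lra.
Qed.

Lemma near_0_infty_pos :
  filter_prod (at_right 0) (Rbar_locally p_infty)
    (fun ab : R * R => 0 < fst ab < 1 /\ 1 < snd ab).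
Proof.
  apply (Filter_prod _ _ _ (fun a => 0 < a < 1) (fun b => 1 < b)).
  - exists (mkposreal 1 Rlt_0_1). intros y Hy Hy0.
    apply ball_R in Hy; simpl in Hy. lra.
  - exists 1. auto.
  - intros a b Ha Hb; simpl; auto.
Qed.

Lemma ex_RInt_pos (f : R -> R) (a b : R) :
  (forall t, 0 < t -> continuous f t) -> 0 < a -> a <= b -> ex_RInt f a b.
Proof.
  intros Hc Ha Hab. apply (ex_RInt_continuous (V := R_CompleteNormedModule)).
  intros z Hz. apply Hc. rewrite Rmin_left in Hz by lra. lra.
Qed.

Lemma RInt_subinterval (f : R -> R) (a b c d : R) :
  (forall t, 0 < t -> continuous f t) -> (forall t, 0 < t -> 0 <= f t) ->
  0 < c -> c <= a -> a <= b -> b <= d -> RInt f a b <= RInt f c d.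
Proof.
  intros Hc Hp H0 Hca Hab Hbd.
  assert (E1 := ex_RInt_pos f c a Hc H0 Hca).
  assert (E2 := ex_RInt_pos f a b Hc ltac:(lra) Hab).
  assert (E3 := ex_RInt_pos f b d Hc ltac:(lra) Hbd).
  rewrite <- (RInt_Chasles f c b d); [|eapply ex_RInt_Chasles; eassumption|assumption].
  rewrite <- (RInt_Chasles f c a b); [|assumption|assumption].
  assert (0 <= RInt f c a) by (apply RInt_ge_0; auto; intros; apply Hp; lra).
  assert (0 <= RInt f b d) by (apply RInt_ge_0; auto; intros; apply Hp; lra).
  unfold plus; simpl. lra.
Qed.

(** The integral over [a, b] grows with the interval, so the improper integral is
    the supremum of these values.  The behaviour of f at 0 enters only through the
    bound B. *)
Lemma ex_RInt_gen_bounded (f : R -> R) (B : R) :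
  (forall t, 0 < t -> continuous f t) -> (forall t, 0 < t -> 0 <= f t) ->
  (forall a b, 0 < a -> a <= b -> RInt f a b <= B) ->
  ex_RInt_gen f (at_right 0) (Rbar_locally p_infty).
Proof.
  intros Hc Hp HB.
  set (E := fun v : R => exists a b, 0 < a /\ a <= b /\ v = RInt f a b).
  destruct (completeness E) as [S [Hub Hlub]].
  - exists B. intros v (a & b & Ha & Hab & ->). auto.
  - exists (RInt f 1 1), 1, 1. repeat split; lra.
  - exists S. intros P [eps HP].
    assert (Hex : exists a b, 0 < a /\ a <= b /\ S - eps < RInt f a b).
    { apply Classical_Prop.NNPP. intros H.
      exfalso. assert (S <= S - eps).
      { apply Hlub. intros v (a & b & Ha & Hab & ->).
        apply Rnot_lt_le. intros Hlt. apply H. exists a, b; auto. }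
      destruct eps as [eps He]; simpl in *; lra. }
    destruct Hex as (a0 & b0 & Ha0 & Hab0 & HS).
    apply (Filter_prod _ _ _ (fun a => 0 < a < a0) (fun b => b0 < b)).
    + exists (mkposreal a0 Ha0). intros y Hy Hy0.
      apply ball_R in Hy; simpl in Hy. lra.
    + exists b0; auto.
    + intros a b Ha Hb. simpl. exists (RInt f a b). split.
      * apply (RInt_correct f). apply ex_RInt_pos; auto; lra.
      * apply HP, ball_R.
        assert (RInt f a b <= S) by (apply Hub; exists a, b; repeat split; lra).
        assert (RInt f a0 b0 <= RInt f a b) by (apply RInt_subinterval; auto; lra).
        lra.
Qed.

(** * The Gamma function: convergence, recurrence, Gautschi's inequality *)

Definition gamma_integrand (x t : R) : R := Rpower t (x - 1) * exp (- t).

Lemma gamma_integrand_pos (x t : R) : 0 < gamma_integrand x t.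
Proof. apply Rmult_lt_0_compat; apply exp_pos. Qed.

(** The pointwise form of the integration by parts behind the recurrence of Gamma:
    integrating this identity over the half-line gives [Gamma_succ]. *)
Lemma is_derive_gamma_integrand (x t : R) : 0 < t ->
  is_derive (gamma_integrand (x + 1)) t (x * gamma_integrand x t - gamma_integrand (x + 1) t).
Proof.
  intros Ht. unfold gamma_integrand, Rpower. auto_derive; auto.
  assert (E : exp ((x + 1 - 1) * ln t) = exp ((x - 1) * ln t) * t).
  { rewrite <- (exp_ln t) at 3 by auto. rewrite <- exp_plus. f_equal. ring. }
  rewrite E. field. lra.
Qed.

Lemma continuous_gamma_integrand (x t : R) : 0 < t -> continuous (gamma_integrand x) t.
Proof.
  intros Ht. replace x with (x - 1 + 1) by ring.
  apply (ex_derive_continuous (gamma_integrand (x - 1 + 1))). eexists. apply is_derive_gamma_integrand; auto.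
Qed.

Lemma ln_le_sub_1 (x : R) : 0 < x -> ln x <= x - 1.
Proof.
  intros H. destruct (Req_dec x 1) as [->|Hx].
  - rewrite ln_1; lra.
  - rewrite <- (exp_ln x) at 2 by auto. assert (ln x <> 0).
    { intros E. apply Hx. rewrite <- (exp_ln x), E, exp_0; auto. }
    assert (H1 := exp_ineq1 (ln x) H0). lra.
Qed.

(** The constant (2(x-1))^(x-1) comes from ln u <= u - 1 <= u at u = t/(2(x-1)),
    the scale at which (x-1) u is exactly t/2. *)
Lemma gamma_integrand_exp_bound (x t : R) : 1 < x -> 0 < t ->
  gamma_integrand x t <= exp ((x - 1) * ln (2 * (x - 1))) * exp (- t / 2).
Proof.
  intros Hx Ht. unfold gamma_integrand, Rpower. rewrite <- !exp_plus.
  assert (H := ln_le_sub_1 (t / (2 * (x - 1))) ltac:(apply Rdiv_lt_0_compat; lra)).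
  unfold Rdiv in H. rewrite ln_mult, ln_Rinv in H; try lra; [|apply Rinv_0_lt_compat; lra].
  assert (H2 : (x - 1) * ln t <= (x - 1) * ln (2 * (x - 1)) + t / 2).
  { apply Rmult_le_compat_l with (r := x - 1) in H; [|lra].
    replace ((x - 1) * (t * / (2 * (x - 1)) - 1)) with (t / 2 - (x - 1)) in H by (field; lra).
    lra. }
  destruct (Rle_lt_or_eq_dec ((x - 1) * ln t + - t) ((x - 1) * ln (2 * (x - 1)) + - t / 2)) as [L|L].
  - lra.
  - left; apply exp_increasing; auto.
  - rewrite L; lra.
Qed.

(** Convergence, stated as the value of the integral so that the linearity and
    comparison rules for improper integrals apply to [Gamma]. *)
Lemma is_RInt_gen_Gamma (x : R) : 1 < x ->
  is_RInt_gen (gamma_integrand x) (at_right 0) (Rbar_locally p_infty) (Gamma x).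
Proof.
  intros Hx. apply (RInt_gen_correct (gamma_integrand x)).
  set (C := exp ((x - 1) * ln (2 * (x - 1)))).
  assert (HC : 0 < C) by apply exp_pos.
  apply (ex_RInt_gen_bounded _ (2 * C)).
  - intros; apply continuous_gamma_integrand; auto.
  - intros; left; apply gamma_integrand_pos.
  - intros a b Ha Hab.
    assert (HI : is_RInt (fun t => C * exp (- t / 2)) a b
        (minus (- 2 * C * exp (- b / 2)) (- 2 * C * exp (- a / 2)))).
    { apply (is_RInt_derive (fun t => - 2 * C * exp (- t / 2))).
      - intros t _. auto_derive; auto. unfold Rdiv; field.
      - intros t _. apply (ex_derive_continuous (fun t => C * exp (- t / 2))). auto_derive; auto. }
    apply Rle_trans with (RInt (fun t => C * exp (- t / 2)) a b).
    + apply RInt_le; auto.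
      * apply ex_RInt_pos; auto; intros; apply continuous_gamma_integrand; auto.
      * eexists; apply HI.
      * intros t Ht. apply gamma_integrand_exp_bound; lra.
    + rewrite (is_RInt_unique _ _ _ _ HI). unfold minus, plus, opp; simpl.
      assert (0 < exp (- b / 2)) by apply exp_pos.
      assert (exp (- a / 2) <= 1).
      { rewrite <- exp_0. left; apply exp_increasing; lra. }
      nra.
Qed.

Lemma gamma_integrand_at_0 (x : R) : 2 < x ->
  filterlim (gamma_integrand x) (at_right 0) (locally 0).
Proof.
  intros Hx P [eps HP].
  assert (Hd : 0 < Rmin 1 eps) by (apply Rmin_glb_lt; [lra|apply cond_pos]).
  exists (mkposreal _ Hd). intros y Hy Hy0. apply HP, ball_R.
  apply ball_R in Hy; simpl in Hy.
  assert (H1 := Rmin_l 1 eps). assert (H2 := Rmin_r 1 eps).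
  assert (Hk := gamma_integrand_pos x y).
  assert (gamma_integrand x y <= y).
  { unfold gamma_integrand, Rpower. rewrite <- exp_plus. rewrite <- (exp_ln y) at 3 by auto.
    assert (ln y < 0) by (rewrite <- ln_1; apply ln_increasing; lra).
    left; apply exp_increasing. nra. }
  lra.
Qed.

Lemma gamma_integrand_at_infty (x : R) : 1 < x ->
  filterlim (gamma_integrand x) (Rbar_locally p_infty) (locally 0).
Proof.
  intros Hx P [eps HP].
  set (C := exp ((x - 1) * ln (2 * (x - 1)))).
  assert (HC : 0 < C) by apply exp_pos.
  assert (He := cond_pos eps).
  exists (2 * C / eps). intros y Hy. apply HP.
  assert (Hq : 0 < 2 * C / eps) by (apply Rdiv_lt_0_compat; lra).
  assert (Hk := gamma_integrand_pos x y).
  assert (Hb := gamma_integrand_exp_bound x y Hx ltac:(lra)). fold C in Hb.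
  assert (H1 := exp_ineq1 (y / 2) ltac:(lra)).
  assert (gamma_integrand x y < eps).
  { eapply Rle_lt_trans. apply Hb. replace (- y / 2) with (- (y / 2)) by field.
    rewrite exp_Ropp.
    apply Rmult_lt_reg_r with (exp (y / 2)). apply exp_pos.
    rewrite Rmult_assoc, Rinv_l, Rmult_1_r by (apply Rgt_not_eq, exp_pos).
    apply Rmult_lt_compat_r with (r := eps) in Hy; [|lra].
    replace (2 * C / eps * eps) with (2 * C) in Hy by (field; lra). nra. }
  apply ball_R. lra.
Qed.

(** Integration by parts; the boundary terms of t^x exp(-t) vanish at both ends. *)
Lemma Gamma_succ (x : R) : 1 < x -> Gamma (x + 1) = x * Gamma x.
Proof.
  intros Hx.
  assert (H1 := is_RInt_gen_Gamma x Hx).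
  assert (H2 := is_RInt_gen_Gamma (x + 1) ltac:(lra)).
  assert (H3 := is_RInt_gen_minus _ _ _ _ (is_RInt_gen_scal _ x _ H1) H2).
  assert (HD : forall t, 0 < t -> Derive (gamma_integrand (x + 1)) t =
      x * gamma_integrand x t - gamma_integrand (x + 1) t).
  { intros t Ht. apply is_derive_unique, is_derive_gamma_integrand; auto. }
  assert (H4 : is_RInt_gen (Derive (gamma_integrand (x + 1))) (at_right 0)
      (Rbar_locally p_infty) (0 - 0)).
  { apply is_RInt_gen_Derive.
    - eapply filter_imp; [|apply near_0_infty_pos]. intros ab H t Ht.
      rewrite Rmin_left in Ht by lra.
      eexists; apply is_derive_gamma_integrand; lra.
    - eapply filter_imp; [|apply near_0_infty_pos]. intros ab H t Ht.
      rewrite Rmin_left in Ht by lra.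
      apply continuous_ext_loc with (fun t => x * gamma_integrand x t - gamma_integrand (x + 1) t).
      + exists (mkposreal t ltac:(lra)). intros y Hy.
        apply ball_R in Hy; simpl in Hy. symmetry; apply HD; lra.
      + apply (continuous_minus (fun t => x * gamma_integrand x t) (gamma_integrand (x + 1))).
        * apply (continuous_scal_r x (gamma_integrand x)). apply continuous_gamma_integrand; lra.
        * apply continuous_gamma_integrand; lra.
    - apply gamma_integrand_at_0; lra.
    - apply gamma_integrand_at_infty; lra. }
  assert (H5 : is_RInt_gen (Derive (gamma_integrand (x + 1))) (at_right 0) (Rbar_locally p_infty)
      (minus (scal x (Gamma x)) (Gamma (x + 1)))).
  { eapply is_RInt_gen_ext; [|apply H3].
    eapply filter_imp; [|apply near_0_infty_pos]. intros ab H t Ht.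
    rewrite Rmin_left in Ht by lra. symmetry. apply HD; lra. }
  assert (E4 := is_RInt_gen_unique (V := R_CompleteNormedModule) _ _ H4).
  apply (is_RInt_gen_unique (V := R_CompleteNormedModule)) in H5.
  rewrite E4 in H5. unfold minus, plus, opp, scal in H5; simpl in H5.
  unfold mult in H5; simpl in H5. lra.
Qed.

Lemma Gamma_pos (x : R) : 1 < x -> 0 < Gamma x.
Proof.
  intros Hx.
  assert (H := is_RInt_gen_Gamma x Hx).
  assert (Hc : forall t, 0 < t -> continuous (gamma_integrand x) t)
    by (intros; apply continuous_gamma_integrand; auto).
  assert (Hp : 0 < RInt (gamma_integrand x) 1 2).
  { apply RInt_gt_0. lra. intros; apply gamma_integrand_pos. intros; apply Hc; lra. }
  apply Rnot_le_lt. intros Hle.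
  assert (HL : locally (Gamma x) (fun v => v < RInt (gamma_integrand x) 1 2)).
  { exists (mkposreal _ Hp). intros y Hy.
    apply ball_R in Hy; simpl in Hy. lra. }
  specialize (H _ HL). unfold filtermapi in H.
  assert (HF : filter_prod (at_right 0) (Rbar_locally p_infty)
    (fun ab : R * R => (0 < fst ab < 1 /\ 1 < snd ab) /\ 2 < snd ab)).
  { apply filter_and. apply near_0_infty_pos.
    apply (Filter_prod _ _ _ (fun a => True) (fun b => 2 < b)).
    - apply filter_true.
    - exists 2; auto.
    - auto. }
  assert (H' := filter_and _ _ H HF).
  apply filter_ex in H'. destruct H' as [[a b] [[y [Hy Hlt]] [[Ha Hb] Hb2]]]. simpl in *.
  rewrite <- (is_RInt_unique _ _ _ _ Hy) in Hlt.
  assert (RInt (gamma_integrand x) 1 2 <= RInt (gamma_integrand x) a b).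
  { apply RInt_subinterval; auto; try lra. intros; left; apply gamma_integrand_pos. }
  lra.
Qed.

(** For 0 <= s <= 1 the function t^s is concave, hence below its tangent at y.
    After scaling by y this is the weighted arithmetic-geometric inequality
    r^s <= (1-s) + s r. *)
Lemma Rpower_tangent (y s t : R) : 0 < y -> 0 < t -> 0 <= s <= 1 ->
  Rpower t s <= Rpower y s * ((1 - s) + s / y * t).
Proof.
  intros Hy Ht Hs.
  set (r := t / y). assert (Hr : 0 < r) by (apply Rdiv_lt_0_compat; auto).
  assert (E : t = y * r) by (unfold r; field; lra).
  rewrite E at 1. rewrite <- Rpower_mult_distr by auto.
  apply Rmult_le_compat_l. left; apply exp_pos.
  replace (s / y * t) with (s * r) by (unfold r; field; lra).
  set (w := (1 - s) + s * r).
  assert (Hw : 0 < w) by (unfold w; nra).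
  (* Concavity of ln: compare ln at r and at 1 with its tangent at their mean w. *)
  assert (H1 := ln_le_sub_1 (r / w) ltac:(apply Rdiv_lt_0_compat; auto)).
  assert (H2 := ln_le_sub_1 (1 / w) ltac:(apply Rdiv_lt_0_compat; lra)).
  unfold Rdiv in H1, H2. rewrite ln_mult, ln_Rinv in H1, H2; try lra; try (apply Rinv_0_lt_compat; lra).
  rewrite ln_1 in H2.
  assert (H3 : s * (r * / w - 1) + (1 - s) * (1 * / w - 1) = 0).
  { replace (s * (r * / w - 1) + (1 - s) * (1 * / w - 1)) with (w * / w - 1)
      by (unfold w in *; field; lra).
    rewrite Rinv_r; lra. }
  assert (H4 : s * ln r <= ln w) by nra.
  unfold Rpower. rewrite <- (exp_ln w) by auto.
  destruct H4 as [H4|H4]; [left; apply exp_increasing; auto | rewrite H4; lra].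
Qed.

(** Integrating the tangent line bound of t^s at y against t^(y-1) exp(-t): the
    choice of y as tangency point makes the weights (1-s) and s add up to 1, because
    Gamma (y+1) / y = Gamma y.  This replaces the log-convexity of Gamma. *)
Lemma Gamma_Gautschi (y s : R) : 1 < y -> 0 <= s <= 1 ->
  Gamma (y + s) <= Rpower y s * Gamma y.
Proof.
  intros Hy Hs.
  assert (H0 := is_RInt_gen_Gamma y Hy).
  assert (H1 := is_RInt_gen_Gamma (y + 1) ltac:(lra)).
  assert (Hl := is_RInt_gen_Gamma (y + s) ltac:(lra)).
  assert (Hr := is_RInt_gen_scal _ (Rpower y s) _
    (is_RInt_gen_plus _ _ _ _ (is_RInt_gen_scal _ (1 - s) _ H0) (is_RInt_gen_scal _ (s / y) _ H1))).
  assert (HN : norm (Gamma (y + s)) <= scal (Rpower y s)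
           (plus (scal (1 - s) (Gamma y)) (scal (s / y) (Gamma (y + 1))))).
  { refine (RInt_gen_norm _ _ _ _ _ _ Hl Hr).
    - eapply filter_imp; [|apply near_0_infty_pos]. intros ab H; lra.
    - eapply filter_imp; [|apply near_0_infty_pos]. intros ab H t Ht.
      unfold norm; simpl; unfold abs; simpl. rewrite Rabs_pos_eq by (left; apply gamma_integrand_pos).
      unfold scal, plus; simpl; unfold mult; simpl. unfold gamma_integrand.
      assert (Ht0 : 0 < t) by lra.
      assert (HT := Rpower_tangent y s t ltac:(lra) Ht0 Hs).
      replace (y + s - 1) with (s + (y - 1)) by ring.
      replace (y + 1 - 1) with (1 + (y - 1)) by ring.
      rewrite !Rpower_plus, Rpower_1 by auto.
      replace (Rpower y s * ((1 - s) * (Rpower t (y - 1) * exp (- t))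
        + s / y * (t * Rpower t (y - 1) * exp (- t))))
       with ((Rpower y s * ((1 - s) + s / y * t)) * (Rpower t (y - 1) * exp (- t))) by ring.
      rewrite Rmult_assoc. apply Rmult_le_compat_r; auto.
      left. apply (gamma_integrand_pos y t). }
  unfold norm in HN; simpl in HN; unfold abs in HN; simpl in HN.
  rewrite Gamma_succ in HN by auto.
  unfold scal, plus in HN; simpl in HN; unfold mult in HN; simpl in HN.
  replace ((1 - s) * Gamma y + s / y * (y * Gamma y)) with (Gamma y) in HN by (field; lra).
  eapply Rle_trans; [apply Rle_abs|apply HN].
Qed.

(** * Differentiating a pointwise limit *)

(** A uniform bound K on the second derivatives h of the f n gives
    |f n y - f n x - g n x (y-x)| <= K (y-x)^2 for all n, and this estimate survives
    the limit in n. *)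
Lemma is_derive_pointwise_lim (f g h : nat -> R -> R) (F : R -> R) (x d K l : R) :
  0 < d ->
  (forall n y, Rabs (y - x) < d -> is_derive (f n) y (g n y)) ->
  (forall n y, Rabs (y - x) < d -> is_derive (g n) y (h n y)) ->
  (forall n y, Rabs (y - x) < d -> Rabs (h n y) <= K) ->
  (forall y, Rabs (y - x) < d -> is_lim_seq (fun n => f n y) (F y)) ->
  is_lim_seq (fun n => g n x) l ->
  is_derive F x l.
Proof.
  intros Hd Hf Hg Hh HF Hl.
  assert (Hx : Rabs (x - x) < d) by (rewrite Rminus_diag, Rabs_R0; auto).
  assert (HK : 0 <= K) by (eapply Rle_trans; [apply Rabs_pos|apply (Hh 0%nat x Hx)]).
  assert (Hmv : forall (u du : R -> R) y, Rabs (y - x) < d ->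
      (forall z, Rabs (z - x) < d -> is_derive u z (du z)) ->
      exists c, Rabs (c - x) <= Rabs (y - x) /\ u y - u x = du c * (y - x)).
  { intros u du y Hy Hu.
    assert (Hin : forall z, Rmin x y <= z <= Rmax x y -> Rabs (z - x) <= Rabs (y - x)).
    { intros z. unfold Rmin, Rmax, Rabs.
      destruct (Rle_dec x y), (Rcase_abs (z - x)), (Rcase_abs (y - x)); lra. }
    destruct (MVT_gen u x y du) as [c [Hc E]].
    - intros z Hz. apply Hu. eapply Rle_lt_trans; [apply Hin; lra|auto].
    - intros z Hz. apply continuity_pt_filterlim.
      apply (ex_derive_continuous u). eexists; apply Hu.
      eapply Rle_lt_trans; [apply Hin; lra|auto].
    - exists c; split; auto. }
  assert (Hq : forall n y, Rabs (y - x) < d ->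
      Rabs (f n y - f n x - g n x * (y - x)) <= K * Rabs (y - x) ^ 2).
  { intros n y Hy.
    destruct (Hmv (f n) (g n) y Hy (fun z => Hf n z)) as [c [Hc ->]].
    destruct (Hmv (g n) (h n) c ltac:(lra) (fun z => Hg n z)) as [c' [Hc' E]].
    replace (g n c * (y - x) - g n x * (y - x)) with (h n c' * (c - x) * (y - x))
      by (rewrite <- E; ring).
    rewrite !Rabs_mult. specialize (Hh n c' ltac:(lra)).
    assert (H1 := Rabs_pos (h n c')). assert (H2 := Rabs_pos (c - x)).
    assert (H3 := Rabs_pos (y - x)). simpl. rewrite Rmult_1_r, <- Rmult_assoc.
    apply Rmult_le_compat_r; auto. apply Rmult_le_compat; auto. }
  assert (HQ : forall y, Rabs (y - x) < d ->
      Rabs (F y - F x - l * (y - x)) <= K * Rabs (y - x) ^ 2).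
  { intros y Hy.
    assert (Hlim : is_lim_seq (fun n => Rabs (f n y - f n x - g n x * (y - x)))
                     (Rabs (F y - F x - l * (y - x)))).
    { apply (is_lim_seq_abs _ (Finite _)).
      apply (is_lim_seq_minus' _ _ (F y - F x) (l * (y - x))).
      - apply is_lim_seq_minus'; auto.
      - apply is_lim_seq_mult'; auto. apply is_lim_seq_const. }
    apply (is_lim_seq_le _ (fun _ => K * Rabs (y - x) ^ 2) _ (Finite (K * Rabs (y - x) ^ 2))
             (fun n => Hq n y Hy) Hlim (is_lim_seq_const _)). }
  apply is_derive_Reals. intros eps Heps.
  assert (Hdel : 0 < Rmin d (eps / (K + 1))).
  { apply Rmin_glb_lt; auto. apply Rdiv_lt_0_compat; lra. }
  exists (mkposreal _ Hdel). intros k Hk Hkd. simpl in Hkd.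
  assert (H1 := Rmin_l d (eps / (K + 1))). assert (H2 := Rmin_r d (eps / (K + 1))).
  assert (H0 := Rabs_pos_lt k Hk).
  assert (Hy : Rabs (x + k - x) < d) by (replace (x + k - x) with k by ring; lra).
  specialize (HQ _ Hy). replace (x + k - x) with k in HQ by ring.
  replace ((F (x + k) - F x) / k - l) with ((F (x + k) - F x - l * k) / k) by (field; auto).
  unfold Rdiv. rewrite Rabs_mult, Rabs_inv.
  apply Rmult_lt_reg_r with (Rabs k); auto.
  rewrite Rmult_assoc, Rinv_l, Rmult_1_r by lra.
  assert (H3 : Rabs k * (K + 1) < eps).
  { apply Rlt_le_trans with (eps / (K + 1) * (K + 1)).
    - apply Rmult_lt_compat_r; lra.
    - right; field; lra. }
  nra.
Qed.

(** * The trigamma function as a series *)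

Lemma is_derive_sum_f_R0 (u du : nat -> R -> R) (x : R) (n : nat) :
  (forall k, is_derive (u k) x (du k x)) ->
  is_derive (fun y => sum_f_R0 (fun k => u k y) n) x (sum_f_R0 (fun k => du k x) n).
Proof.
  intros H. induction n as [|n IH]; simpl; auto.
  apply (is_derive_plus (fun y => sum_f_R0 (fun k => u k y) n) (u (S n))); auto.
Qed.

Definition digamma_seq (n : nat) (x : R) : R :=
  ln (x + INR (S n)) - sum_f_R0 (fun k => / (x + INR k)) n.

(** The extra term 1/(x+n+1), the derivative of the logarithm in [digamma_seq],
    tends to 0; it makes [trigamma_seq n] the exact derivative of [digamma_seq n]. *)
Definition trigamma_seq (n : nat) (x : R) : R :=
  / (x + INR (S n)) + sum_f_R0 (fun k => / (x + INR k) ^ 2) n.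

(** An antiderivative of ln: its increments over intervals of bounded length, though
    not its values, approach those of ln Gamma at infinity. *)
Definition stirling (y : R) : R := y * ln y - y.

Lemma ln_diff_bounds (a b : R) : 0 < a -> 0 < b -> (b - a) / b <= ln b - ln a <= (b - a) / a.
Proof.
  intros Ha Hb.
  assert (H1 := ln_le_sub_1 (b * / a) ltac:(apply Rmult_lt_0_compat; auto using Rinv_0_lt_compat)).
  assert (H2 := ln_le_sub_1 (a * / b) ltac:(apply Rmult_lt_0_compat; auto using Rinv_0_lt_compat)).
  rewrite ln_mult, ln_Rinv in H1, H2; auto using Rinv_0_lt_compat.
  replace ((b - a) / b) with (1 - a * / b) by (field; lra).
  replace ((b - a) / a) with (b * / a - 1) by (field; lra). lra.
Qed.

(** Gautschi's inequality from y to y+s bounds the increment of ln Gamma above by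
    s ln y; from y+s to y+1 it bounds it below by ln y - (1-s) ln (y+s).  The
    increment of the Stirling function, the integral of ln over [y, y+s], lies
    within 1/y of s ln y as well. *)
Lemma ln_Gamma_stirling_increment (y s : R) : 1 < y -> 0 <= s <= 1 ->
  Rabs ((ln (Gamma (y + s)) - stirling (y + s)) - (ln (Gamma y) - stirling y)) <= 2 / y.
Proof.
  intros Hy Hs.
  assert (G0 := Gamma_pos y Hy). assert (G1 := Gamma_pos (y + s) ltac:(lra)).
  assert (U : ln (Gamma (y + s)) <= s * ln y + ln (Gamma y)).
  { assert (H := Gamma_Gautschi y s Hy Hs). apply ln_le in H; auto.
    rewrite ln_mult in H by (auto; apply exp_pos). unfold Rpower in H. rewrite ln_exp in H. auto. }
  assert (V : ln y + ln (Gamma y) <= (1 - s) * ln (y + s) + ln (Gamma (y + s))).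
  { assert (H := Gamma_Gautschi (y + s) (1 - s) ltac:(lra) ltac:(lra)).
    replace (y + s + (1 - s)) with (y + 1) in H by ring. rewrite Gamma_succ in H by auto.
    apply ln_le in H; [|apply Rmult_lt_0_compat; lra].
    rewrite !ln_mult in H by (auto; try apply exp_pos; lra).
    unfold Rpower in H. rewrite ln_exp in H. auto. }
  destruct (ln_diff_bounds y (y + s) ltac:(lra) ltac:(lra)) as [D1 D2].
  replace (y + s - y) with s in D1, D2 by ring.
  unfold stirling.
  assert (E1 : s <= (y + s) * (ln (y + s) - ln y)).
  { apply Rmult_le_compat_l with (r := y + s) in D1; [|lra].
    replace ((y + s) * (s / (y + s))) with s in D1 by (field; lra). auto. }
  assert (E2 : (y + s) * (ln (y + s) - ln y) <= s + 1 / y).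
  { apply Rmult_le_compat_l with (r := y + s) in D2; [|lra].
    eapply Rle_trans; [apply D2|]. apply Rmult_le_reg_r with y; [lra|].
    replace ((y + s) * (s / y) * y) with ((y + s) * s) by (field; lra).
    replace ((s + 1 / y) * y) with (s * y + 1) by (field; lra). nra. }
  assert (E3 : ln (y + s) - ln y <= 1 / y).
  { eapply Rle_trans; [apply D2|]. apply Rmult_le_compat_r; [|lra]. left; apply Rinv_0_lt_compat; lra. }
  assert (E4 : 0 <= ln (y + s) - ln y).
  { eapply Rle_trans; [|apply D1]. apply Rdiv_le_0_compat; lra. }
  replace (2 / y) with (1 / y + 1 / y) by (field; lra).
  apply Rabs_le. nra.
Qed.

Lemma ln_Gamma_shift (x : R) (n : nat) : 1 < x ->
  ln (Gamma x) = ln (Gamma (x + INR (S n))) - sum_f_R0 (fun k => ln (x + INR k)) n.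
Proof.
  intros Hx.
  assert (Hs : forall y, 1 < y -> ln (Gamma (y + 1)) = ln y + ln (Gamma y)).
  { intros y Hy. rewrite Gamma_succ by auto. apply ln_mult; [lra|apply Gamma_pos; auto]. }
  induction n as [|n IH].
  - simpl. rewrite Hs by auto. rewrite Rplus_0_r. ring.
  - assert (Hn := pos_INR (S n)). rewrite tech5, (S_INR (S n)), <- Rplus_assoc, Hs by lra.
    rewrite IH. ring.
Qed.

Lemma is_lim_seq_inv_shift (x c : R) : is_lim_seq (fun n => c / (x + INR (S n))) 0.
Proof.
  replace (Finite 0) with (Rbar_mult c (Rbar_inv p_infty)) by (simpl; f_equal; ring).
  apply is_lim_seq_scal_l. apply is_lim_seq_inv; [|discriminate].
  eapply is_lim_seq_plus.
  - apply is_lim_seq_const.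
  - apply (is_lim_seq_incr_1 INR). apply is_lim_seq_INR.
  - reflexivity.
Qed.

(** Telescoping bound from 1/y^2 <= 1/(y-1) - 1/y. *)
Lemma sum_inv_sqr_le (x : R) (n : nat) : 1 < x ->
  sum_f_R0 (fun k => / (x + INR k) ^ 2) n <= / (x - 1) - / (x + INR n).
Proof.
  intros Hx.
  assert (Hs : forall y, 1 < y -> / y ^ 2 <= / (y - 1) - / y).
  { intros y Hy. replace (/ (y - 1) - / y) with (/ ((y - 1) * y)) by (field; lra).
    apply Rinv_le_contravar; nra. }
  induction n as [|n IH].
  - simpl sum_f_R0. apply Rle_trans with (1 := Hs (x + INR 0) ltac:(simpl; lra)).
    simpl INR. rewrite Rplus_0_r. lra.
  - rewrite tech5. assert (Hn := pos_INR n).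
    assert (H := Hs (x + INR (S n)) ltac:(rewrite S_INR; lra)).
    replace (x + INR (S n) - 1) with (x + INR n) in H by (rewrite S_INR; ring). lra.
Qed.

Lemma sum_inv_sqr_pos (x : R) (n : nat) : 1 < x ->
  0 <= sum_f_R0 (fun k => / (x + INR k) ^ 2) n.
Proof.
  intros Hx. apply cond_pos_sum. intros k. assert (Hk := pos_INR k).
  left. apply Rinv_0_lt_compat, pow_lt. lra.
Qed.

Lemma trigamma_seq_bounds (x : R) (n : nat) : 1 < x ->
  0 <= trigamma_seq n x <= / (x - 1).
Proof.
  intros Hx. unfold trigamma_seq. assert (H := sum_inv_sqr_le x n Hx).
  assert (H0 := sum_inv_sqr_pos x n Hx). assert (Hn := pos_INR n).
  assert (0 < / (x + INR (S n))) by (apply Rinv_0_lt_compat; rewrite S_INR; lra).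
  assert (/ (x + INR (S n)) <= / (x + INR n)) by (apply Rinv_le_contravar; rewrite ?S_INR; lra).
  lra.
Qed.

Lemma is_lim_seq_sum_inv_sqr (x : R) : 1 < x ->
  exists l : R, is_lim_seq (fun n => sum_f_R0 (fun k => / (x + INR k) ^ 2) n) l.
Proof.
  intros Hx. apply (ex_finite_lim_seq_incr _ (/ (x - 1))).
  - intros n. rewrite tech5. assert (Hn := pos_INR (S n)).
    assert (0 < / (x + INR (S n)) ^ 2) by (apply Rinv_0_lt_compat, pow_lt; lra). lra.
  - intros n. assert (H := trigamma_seq_bounds x n Hx). unfold trigamma_seq in H.
    assert (Hn := pos_INR (S n)).
    assert (0 < / (x + INR (S n))) by (apply Rinv_0_lt_compat; lra). lra.
Qed.

(** The sequence decreases since ln (1 + 1/y) <= 1/y, and it is bounded below since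
    1/y <= ln y - ln (y-1) telescopes. *)
Lemma is_lim_seq_digamma_seq (x : R) : 1 < x ->
  is_lim_seq (fun n => digamma_seq n x) (real (Lim_seq (fun n => digamma_seq n x))).
Proof.
  intros Hx. apply Lim_seq_correct'. apply (ex_finite_lim_seq_decr _ (ln (x - 1))).
  - intros n. unfold digamma_seq. rewrite tech5. assert (Hn := pos_INR (S n)).
    destruct (ln_diff_bounds (x + INR (S n)) (x + INR (S (S n)))) as [_ H]; rewrite ?(S_INR (S n)); try lra.
    rewrite (S_INR (S n)) in H.
    replace ((x + (INR (S n) + 1) - (x + INR (S n))) / (x + INR (S n))) with (/ (x + INR (S n))) in H
      by (field; lra).
    lra.
  - intros n.
    assert (H : sum_f_R0 (fun k => / (x + INR k)) n <= ln (x + INR n) - ln (x - 1)).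
    { assert (Hs : forall y, 1 < y -> / y <= ln y - ln (y - 1)).
      { intros y Hy. destruct (ln_diff_bounds (y - 1) y) as [H _]; lra. }
      induction n as [|n IH].
      - simpl. rewrite Rplus_0_r. auto.
      - rewrite tech5. assert (Hn := pos_INR n).
        assert (H := Hs (x + INR (S n)) ltac:(rewrite S_INR; lra)).
        replace (x + INR (S n) - 1) with (x + INR n) in H by (rewrite S_INR; ring). lra. }
    unfold digamma_seq. assert (Hn := pos_INR n).
    assert (ln (x + INR n) < ln (x + INR (S n))) by (apply ln_increasing; rewrite ?S_INR; lra).
    lra.
Qed.

Lemma is_derive_digamma_seq (n : nat) (x : R) : 0 < x ->
  is_derive (digamma_seq n) x (trigamma_seq n x).
Proof.
  intros Hx. assert (Hn : forall k, 0 < x + INR k) by (intros k; assert (H := pos_INR k); lra).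
  unfold digamma_seq, trigamma_seq.
  replace (/ (x + INR (S n)) + sum_f_R0 (fun k => / (x + INR k) ^ 2) n) with
    (minus (/ (x + INR (S n))) (sum_f_R0 (fun k => - / (x + INR k) ^ 2) n)).
  - apply (is_derive_minus (fun y => ln (y + INR (S n)))).
    + specialize (Hn (S n)). generalize dependent (INR (S n)). intros c Hc.
      auto_derive; [auto|field; lra].
    + apply (is_derive_sum_f_R0 (fun k y => / (y + INR k)) (fun k y => - / (y + INR k) ^ 2)).
      intros k. specialize (Hn k). auto_derive; [lra|field; lra].
  - unfold minus, plus, opp; simpl. f_equal.
    rewrite <- (Rmult_1_l (sum_f_R0 (fun k => / _) n)), <- (Ropp_involutive 1), Ropp_mult_distr_l_reverse.
    f_equal. rewrite scal_sum. apply sum_eq. intros; ring.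
Qed.

(** A bound independent of n, as differentiating the limit of [digamma_seq]
    demands. *)
Lemma is_derive_trigamma_seq (n : nat) (x : R) : 1 < x ->
  exists l, is_derive (trigamma_seq n) x l /\ Rabs l <= 2 / (x - 1).
Proof.
  intros Hx. assert (Hn : forall k, 0 < x + INR k) by (intros k; assert (H := pos_INR k); lra).
  exists (plus (- / (x + INR (S n)) ^ 2) (sum_f_R0 (fun k => - 2 / (x + INR k) ^ 3) n)). split.
  - unfold trigamma_seq. apply (is_derive_plus (fun y => / (y + INR (S n)))).
    + specialize (Hn (S n)). generalize dependent (INR (S n)). intros c Hc.
      auto_derive; [lra|field; lra].
    + apply (is_derive_sum_f_R0 (fun k y => / (y + INR k) ^ 2) (fun k y => - 2 / (y + INR k) ^ 3)).
      intros k. specialize (Hn k). auto_derive; [|field; lra].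
      apply Rgt_not_eq, Rmult_lt_0_compat; lra.
  - change plus with Rplus.
    assert (Hp : forall p y, 1 < y -> 0 < / y ^ p /\ / y ^ (S p) <= / y ^ p).
    { intros p y Hy. assert (1 <= y ^ p) by (apply pow_R1_Rle; lra).
      assert (0 < y ^ p) by lra. split.
      - apply Rinv_0_lt_compat; auto.
      - apply Rinv_le_contravar; auto. simpl. nra. }
    assert (Hk : forall k, 1 < x + INR k) by (intros k; assert (H := pos_INR k); lra).
    assert (H := trigamma_seq_bounds x n Hx). unfold trigamma_seq in H.
    assert (B1 : - 2 * sum_f_R0 (fun k => / (x + INR k) ^ 2) n
        <= sum_f_R0 (fun k => - 2 / (x + INR k) ^ 3) n <= 0).
    { split.
      - rewrite scal_sum. apply sum_Rle. intros k _. destruct (Hp 2%nat _ (Hk k)) as [_ H1]. unfold Rdiv. lra.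
      - rewrite <- (Rmult_0_l (INR (S n))), <- sum_cte. apply sum_Rle. intros k _.
        destruct (Hp 3%nat _ (Hk k)) as [H1 _]. unfold Rdiv. lra. }
    destruct (Hp 1%nat _ (Hk (S n))) as [_ B2]. destruct (Hp 2%nat _ (Hk (S n))) as [B3 _].
    rewrite pow_1 in B2. unfold Rdiv. apply Rabs_le. lra.
Qed.

(** The approximants of ln Gamma are stirling (y+n+1) - sum_(k<=n) ln (y+k) + c n,
    whose derivative is exactly [digamma_seq n].  By the recurrence their error at y
    is the increment of ln Gamma - stirling between b+n+1 and y+n+1 once c n makes
    it vanish at b; with b = x - 1/2 every y within 1/2 of x has y - b in [0, 1], the
    range of [ln_Gamma_stirling_increment]. *)
Lemma is_derive_ln_Gamma (x : R) : 2 < x ->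
  is_derive (fun y => ln (Gamma y)) x (real (Lim_seq (fun n => digamma_seq n x))).
Proof.
  intros Hx. set (b := x - / 2).
  set (c := fun n => ln (Gamma (b + INR (S n))) - stirling (b + INR (S n))).
  apply (is_derive_pointwise_lim
    (fun n y => stirling (y + INR (S n)) - sum_f_R0 (fun k => ln (y + INR k)) n + c n)
    digamma_seq trigamma_seq _ x (/ 2) 2).
  - lra.
  - intros n y Hy. apply Rabs_def2 in Hy.
    assert (Hn : forall k, 0 < y + INR k) by (intros k; assert (H := pos_INR k); lra).
    unfold digamma_seq.
    replace (ln (y + INR (S n)) - sum_f_R0 (fun k => / (y + INR k)) n) with
      (plus (minus (ln (y + INR (S n))) (sum_f_R0 (fun k => / (y + INR k)) n)) 0)
      by (unfold plus, minus, plus, opp; simpl; ring).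
    apply (is_derive_plus _ (fun _ => c n));
      [|exact (is_derive_const (V := R_NormedModule) (c n) y)].
    apply (is_derive_minus (fun y => stirling (y + INR (S n)))).
    + unfold stirling. specialize (Hn (S n)). generalize dependent (INR (S n)). intros a Ha.
      auto_derive; [auto|field; lra].
    + apply (is_derive_sum_f_R0 (fun k y => ln (y + INR k)) (fun k y => / (y + INR k))).
      intros k. specialize (Hn k). auto_derive; [lra|field; lra].
  - intros n y Hy. apply Rabs_def2 in Hy. apply is_derive_digamma_seq; lra.
  - intros n y Hy. apply Rabs_def2 in Hy.
    destruct (trigamma_seq_bounds y n ltac:(lra)) as [H0 H1].
    rewrite Rabs_pos_eq by auto. eapply Rle_trans; [apply H1|].
    rewrite <- (Rinv_inv 2). apply Rinv_le_contravar; lra.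
  - intros y Hy. apply Rabs_def2 in Hy.
    apply (is_lim_seq_ext (fun n => ln (Gamma y) -
      ((ln (Gamma (b + INR (S n) + (y - b))) - stirling (b + INR (S n) + (y - b)))
        - (ln (Gamma (b + INR (S n))) - stirling (b + INR (S n)))))).
    + intros n. rewrite (ln_Gamma_shift y n) by lra.
      replace (b + INR (S n) + (y - b)) with (y + INR (S n)) by ring. unfold c. ring.
    + replace (Finite (ln (Gamma y))) with (Finite (ln (Gamma y) - 0)) by (f_equal; ring).
      apply (is_lim_seq_minus' _ _ _ 0); [apply is_lim_seq_const|].
      apply is_lim_seq_abs_0.
      apply (is_lim_seq_le_le (fun _ => 0) _ (fun n => 2 / (b + INR (S n)))).
      * intros n. split; [apply Rabs_pos|]. assert (H := pos_INR (S n)).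
        apply ln_Gamma_stirling_increment; unfold b; lra.
      * apply is_lim_seq_const.
      * apply is_lim_seq_inv_shift.
  - apply is_lim_seq_digamma_seq; lra.
Qed.

Lemma is_lim_seq_trigamma (x : R) : 2 < x ->
  is_lim_seq (fun n => sum_f_R0 (fun k => / (x + INR k) ^ 2) n) (trigamma x).
Proof.
  intros Hx. destruct (is_lim_seq_sum_inv_sqr x ltac:(lra)) as [l Hl].
  enough (E : trigamma x = l) by (rewrite E; auto).
  apply is_derive_unique.
  apply (is_derive_pointwise_lim digamma_seq trigamma_seq (fun n => Derive (trigamma_seq n))
           _ x ((x - 2) / 2) 2).
  - lra.
  - intros n y Hy. apply Rabs_def2 in Hy. apply is_derive_digamma_seq; lra.
  - intros n y Hy. apply Rabs_def2 in Hy.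
    destruct (is_derive_trigamma_seq n y ltac:(lra)) as [d [Hd _]].
    apply Derive_correct. eexists; apply Hd.
  - intros n y Hy. apply Rabs_def2 in Hy.
    destruct (is_derive_trigamma_seq n y ltac:(lra)) as [d [Hd HB]].
    rewrite (is_derive_unique _ _ _ Hd). eapply Rle_trans; [apply HB|].
    apply Rmult_le_reg_r with (y - 1); [lra|]. unfold Rdiv.
    rewrite Rmult_assoc, Rinv_l by lra. lra.
  (* The formula for digamma holds beyond 2, hence the radius (x - 2) / 2. *)
  - intros y Hy. apply Rabs_def2 in Hy. unfold digamma.
    assert (E := is_derive_unique _ _ _ (is_derive_ln_Gamma y ltac:(lra))).
    rewrite (E : Derive (fun z => ln (Gamma z)) y = Lim_seq (fun n => digamma_seq n y)).
    apply is_lim_seq_digamma_seq; lra.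
  - rewrite <- (Rplus_0_l l). apply is_lim_seq_plus'; auto.
    apply (is_lim_seq_ext (fun n => 1 / (x + INR (S n)))).
    + intros n. unfold Rdiv. ring.
    + apply is_lim_seq_inv_shift.
Qed.

(** * Rational bounds by telescoping *)

(** The gap v 0 - u 0 of the first terms keeps the inequality strict in the limit. *)
Lemma series_lt (u v : nat -> R) (U V : R) :
  (forall k, u k < v k) ->
  is_lim_seq (sum_f_R0 u) U -> is_lim_seq (sum_f_R0 v) V -> U < V.
Proof.
  intros H HU HV.
  assert (Hd : forall n, sum_f_R0 u n + (v 0%nat - u 0%nat) <= sum_f_R0 v n).
  { induction n as [|n IH]; simpl; [lra|]. specialize (H (S n)). lra. }
  assert (HU' := is_lim_seq_plus' _ _ _ _ HU (is_lim_seq_const (v 0%nat - u 0%nat))).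
  assert (HL := is_lim_seq_le _ _ _ _ Hd HU' HV). simpl in HL.
  specialize (H 0%nat). lra.
Qed.

Lemma is_lim_seq_telescope (p : R -> R) (x : R) : 0 < x ->
  continuous p 0 -> p 0 = 0 ->
  is_lim_seq (sum_f_R0 (fun k => p (/ (x + INR k)) - p (/ (x + INR k + 1)))) (p (/ x)).
Proof.
  intros Hx Hc H0.
  apply (is_lim_seq_ext (fun n => p (/ x) - p (1 / (x + INR (S n))))).
  - induction n as [|n IH].
    + simpl. rewrite Rplus_0_r. unfold Rdiv. rewrite Rmult_1_l. auto.
    + rewrite tech5, <- IH, (S_INR (S n)), <- Rplus_assoc. unfold Rdiv. rewrite !Rmult_1_l. ring.
  - replace (Finite (p (/ x))) with (Finite (p (/ x) - p 0)) by (rewrite H0; f_equal; ring).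
    apply is_lim_seq_minus'; [apply is_lim_seq_const|].
    apply is_lim_seq_continuous; [|apply is_lim_seq_inv_shift].
    apply continuity_pt_filterlim. exact Hc.
Qed.

(** The asymptotic expansion of the trigamma function in powers of t = 1/x, cut
    after t^7; the coefficients of t^(2k+1) are the Bernoulli numbers. *)
Definition upper_poly (t : R) : R := t + t ^ 2 / 2 + t ^ 3 / 6 - t ^ 5 / 30 + t ^ 7 / 42.
Definition lower_poly (t : R) : R := upper_poly t - t ^ 9 / 30.

(** In the variable t = 1/x the comparison of exponentials starts from t = 0, where
    both sides are 1. *)
Definition m_poly (t : R) : R := t - t ^ 4 / 24 + 7 * t ^ 6 / 360.
Definition M_poly (t : R) : R := m_poly t + t ^ 7 / 90.

(** The term t^9 makes the telescoped truncation smaller than the series: clearing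
    denominators leaves a polynomial in y with positive coefficients. *)
Lemma trigamma_gt_lower (x : R) : 2 < x -> lower_poly (/ x) < trigamma x.
Proof.
  intros Hx. eapply series_lt; [|apply is_lim_seq_telescope|apply is_lim_seq_trigamma; auto].
  - intros k. simpl. assert (Hk := pos_INR k). set (y := x + INR k).
    assert (Hy : 0 < y) by (unfold y; lra).
    apply Rlt_0_minus.
    replace (/ (y * (y * 1)) - (lower_poly (/ y) - lower_poly (/ (y + 1)))) with
     ((1/30 + 3/10*y + 247/210*y^2 + 181/70*y^3 + 709/210*y^4 + 5/2*y^5 + 5/6*y^6)
        / (y * (y + 1)) ^ 9) by (unfold lower_poly, upper_poly; field; lra).
    apply Rdiv_lt_0_compat; [|apply pow_lt; nra].
    assert (Hp := fun n => pow_lt y n Hy).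
    pose proof (Hp 2%nat). pose proof (Hp 3%nat). pose proof (Hp 4%nat). pose proof (Hp 5%nat).
    pose proof (Hp 6%nat). lra.
  - lra.
  - apply (ex_derive_continuous lower_poly). unfold lower_poly, upper_poly. auto_derive; auto.
  - unfold lower_poly, upper_poly. field.
Qed.

(** Cut after the positive term t^7, the expansion errs in the other direction. *)
Lemma trigamma_lt_upper (x : R) : 2 < x -> trigamma x < upper_poly (/ x).
Proof.
  intros Hx. eapply series_lt; [|apply is_lim_seq_trigamma; auto|apply is_lim_seq_telescope].
  - intros k. simpl. assert (Hk := pos_INR k). set (y := x + INR k).
    assert (Hy : 0 < y) by (unfold y; lra).
    apply Rlt_0_minus.
    replace (upper_poly (/ y) - upper_poly (/ (y + 1)) - / (y * (y * 1))) with
     ((1/42 + 1/6*y + 7/15*y^2 + 3/5*y^3 + 3/10*y^4) / (y * (y + 1)) ^ 7)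
      by (unfold upper_poly; field; lra).
    apply Rdiv_lt_0_compat; [|apply pow_lt; nra].
    assert (Hp := fun n => pow_lt y n Hy).
    pose proof (Hp 2%nat). pose proof (Hp 3%nat). pose proof (Hp 4%nat). lra.
  - lra.
  - apply (ex_derive_continuous upper_poly). unfold upper_poly. auto_derive; auto.
  - unfold upper_poly. field.
Qed.

(** * Exponential bounds in t = 1/x *)

(** With s = 1 or s = -1 this gives either order between 1 + p and exp q: the
    derivative of (1 + p) exp(-q), which is 1 at 0, is
    (p' - q' (1 + p)) exp(-q). *)
Lemma one_plus_vs_exp (s : R) (p q dp dq : R -> R) (t : R) : 0 <= t ->
  (forall z, is_derive p z (dp z)) -> (forall z, is_derive q z (dq z)) ->
  p 0 = 0 -> q 0 = 0 ->
  (forall z, 0 <= z <= t -> 0 <= s * (dp z - dq z * (1 + p z))) ->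
  0 <= s * (1 + p t - exp (q t)).
Proof.
  intros Ht Hp Hq Hp0 Hq0 H.
  assert (Hd : forall z, is_derive (fun z => (1 + p z) * exp (- q z)) z
             ((dp z - dq z * (1 + p z)) * exp (- q z))).
  { intros z. assert (Ep := is_derive_unique _ _ _ (Hp z)). assert (Eq := is_derive_unique _ _ _ (Hq z)).
    auto_derive.
    - repeat split; eexists; eauto.
    - rewrite (Ep : Derive (fun x => p x) z = _), (Eq : Derive (fun x => q x) z = _). ring. }
  destruct (MVT_gen _ 0 t _ (fun z _ => Hd z)) as [c [Hc E]].
  - intros z _. apply continuity_pt_filterlim.
    apply (ex_derive_continuous (fun z => (1 + p z) * exp (- q z))). eexists; apply Hd.
  - rewrite Rmin_left, Rmax_right in Hc by auto.
    rewrite Hp0, Hq0, Ropp_0, exp_0, Rplus_0_r, Rmult_1_r in E.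
    replace (s * (1 + p t - exp (q t))) with
      (s * (dp c - dq c * (1 + p c)) * (exp (- q c) * t * exp (q t))).
    + apply Rmult_le_pos; [auto|]. assert (H1 := exp_pos (- q c)). assert (H2 := exp_pos (q t)).
      apply Rmult_le_pos; [apply Rmult_le_pos|]; lra.
    + replace (1 + p t - exp (q t)) with (((1 + p t) * exp (- q t) - 1) * exp (q t)).
      * rewrite E. ring.
      * rewrite exp_Ropp. field. apply Rgt_not_eq, exp_pos.
Qed.

(** The polynomial p' - q' (1 + p) starts with 7/90 z^6, since 1 + p and exp m first
    differ at order 7, by z^7/90.  On [0, 1/3] the constant 7/90 dominates the
    negative terms. *)
Lemma exp_m_poly_le_lower (t : R) : 0 <= t <= / 3 -> exp (m_poly t) <= 1 + lower_poly t.
Proof.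
  intros Ht.
  enough (0 <= 1 * (1 + lower_poly t - exp (m_poly t))) by lra.
  apply (one_plus_vs_exp 1 lower_poly m_poly
    (fun z => 1 + z + z ^ 2 / 2 - z ^ 4 / 6 + z ^ 6 / 6 - 3 / 10 * z ^ 8)
    (fun z => 1 - z ^ 3 / 6 + 7 / 60 * z ^ 5)); [lra| | | | |].
  - intros z. unfold lower_poly, upper_poly. auto_derive; auto. field.
  - intros z. unfold m_poly. auto_derive; auto. field.
  - unfold lower_poly, upper_poly. field.
  - unfold m_poly. field.
  - intros z Hz.
    replace (1 * _) with (z ^ 6 * (7/90 - 23/280*z - 13/40*z^2 + 1/30*z^3 + 11/1400*z^4
      - 1/120*z^6 + 7/1800*z^8)) by (unfold lower_poly, upper_poly; field).
    apply Rmult_le_pos; [apply pow_le; lra|].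
    assert (Hp := fun n => pow_le z n (proj1 Hz)).
    pose proof (Hp 3%nat). pose proof (Hp 4%nat). pose proof (Hp 8%nat).
    assert (z ^ 2 <= (/ 3) ^ 2) by (apply pow_incr; lra).
    assert (z ^ 6 <= (/ 3) ^ 6) by (apply pow_incr; lra).
    lra.
Qed.

(** The term z^7/90 of M removes the discrepancy of order 7, so the polynomial
    q' (1 + p) - p' starts at z^7, with a positive coefficient. *)
Lemma upper_poly_le_exp_M (t : R) : 0 <= t <= / 3 -> 1 + upper_poly t <= exp (M_poly t).
Proof.
  intros Ht.
  enough (0 <= -1 * (1 + upper_poly t - exp (M_poly t))) by lra.
  apply (one_plus_vs_exp (-1) upper_poly M_poly
    (fun z => 1 + z + z ^ 2 / 2 - z ^ 4 / 6 + z ^ 6 / 6)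
    (fun z => 1 - z ^ 3 / 6 + 7 / 60 * z ^ 5 + 7 / 90 * z ^ 6)); [lra| | | | |].
  - intros z. unfold upper_poly. auto_derive; auto. field.
  - intros z. unfold M_poly, m_poly. auto_derive; auto. field.
  - unfold upper_poly. field.
  - unfold M_poly, m_poly. field.
  - intros z Hz.
    replace (-1 * _) with (z ^ 7 * (403/2520 + 23/360*z + 7/540*z^2 - 11/1400*z^3 - 7/2700*z^4
      + 1/360*z^5 + 1/540*z^6)) by (unfold upper_poly; field).
    apply Rmult_le_pos; [apply pow_le; lra|].
    assert (Hp := fun n => pow_le z n (proj1 Hz)).
    pose proof (Hp 2%nat). pose proof (Hp 5%nat). pose proof (Hp 6%nat).
    assert (z ^ 3 <= (/ 3) ^ 3) by (apply pow_incr; lra).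
    assert (z ^ 4 <= (/ 3) ^ 4) by (apply pow_incr; lra).
    lra.
Qed.

Theorem theorem1p2 : forall x : R, 3 <= x ->
  exp (m x) - 1 < trigamma x < exp (M x) - 1.
Proof.
  intros x Hx.
  assert (Ht : 0 < / x <= / 3) by (split; [apply Rinv_0_lt_compat|apply Rinv_le_contravar]; lra).
  assert (Em : m x = m_poly (/ x)) by (unfold m, m_poly; field; lra).
  assert (EM : M x = M_poly (/ x)) by (unfold M, M_poly; rewrite Em; field; lra).
  rewrite Em, EM.
  assert (HL := trigamma_gt_lower x ltac:(lra)).
  assert (HU := trigamma_lt_upper x ltac:(lra)).
  assert (exp_lower := exp_m_poly_le_lower (/ x) ltac:(lra)).
  assert (exp_upper := upper_poly_le_exp_M (/ x) ltac:(lra)).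
  lra.
Qed.
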